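(* Let $n,k,d$ be positive integers with $k \le d < n$, and let $\alpha>0$. For every integer $i$ with $1 \le i \le k$, $$ C^{\text{exact}}_{n,k,d}\!\left(\alpha,\frac{(d-k+i)\alpha}{d-k+1}\right) \;\geq\; \frac{n i \alpha}{n-k+i}. $$
   Context: A distributed storage system (regenerating code) with parameters $(n,k,d)$, node size $\alpha$ and total repair bandwidth $\gamma$ stores a file on $n$ nodes, each node storing an amount $\alpha$ of information, such that the file can be reconstructed from the contents of any $k$ nodes, and any lost node can be repaired by contacting any $d$ of the remaining nodes, each of which transmits an amount $\beta=\gamma/d$ to the new node. The code has exact repair if the repaired node stores exactly the same content as the lost node. $C^{\text{exact}}_{n,k,d}(\alpha,\gamma)$ denotes the capacity (maximum storable file size) of exact-repair codes with these parameters. Amounts of information are treated as arbitrarily divisible, so capacities are positively homogeneous: $C^{\text{exact}}_{n,k,d}(c\alpha,c\gamma)=c\,C^{\text{exact}}_{n,k,d}(\alpha,\gamma)$ for $c>0$. *)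

(* Defs.v *)
From HB Require Import structures.
From mathcomp Require Import all_boot all_order all_algebra.
From mathcomp Require Import all_classical all_reals all_analysis.
Set Implicit Arguments. Unset Strict Implicit. Unset Printing Implicit Defensive.
Import Order.TTheory GRing.Theory Num.Theory.
Local Open Scope classical_set_scope.
Local Open Scope ring_scope.

(* A deterministic (n,k,d) exact-repair regenerating code storing a file
   w drawn from M possible files ('I_M), each node storing a symbol of an
   alphabet of size A ('I_A), each helper sending a symbol of an alphabet of
   size b ('I_b) during repair.
   - data reconstruction: the contents of any k nodes determine the file;
   - exact repair: for every failed node i and every set D of d other nodes,
     there are helper-message functions (depending on i, D and the helper j)
     such that the messages from the nodes in D determine exactly the lost
     content of node i. *)
Definition exact_repair_code (n k d M A b : nat) : Prop :=
  exists store : 'I_n -> 'I_M -> 'I_A,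
    (forall K : {set 'I_n}, #|K| = k ->
       forall w1 w2 : 'I_M,
         (forall j, j \in K -> store j w1 = store j w2) -> w1 = w2) /\
    (forall (i : 'I_n) (D : {set 'I_n}), #|D| = d -> i \notin D ->
       exists msg : 'I_n -> 'I_A -> 'I_b,
         forall w1 w2 : 'I_M,
           (forall j, j \in D -> msg j (store j w1) = msg j (store j w2)) ->
           store i w1 = store i w2).

(* Normalized achievable file sizes for node size alpha and total repair
   bandwidth gamma (beta = gamma/d per helper): a code with scaling s > 0
   (amount of information measured as ln of alphabet sizes divided by s)
   with ln A <= s*alpha and ln b <= s*gamma/d achieves file size ln M / s.
   Arbitrary divisibility is modelled by the free scaling s. *)
Definition achievable_sizes {R : realType} (n k d : nat) (alpha gamma : R)
  : set R :=
  [set x | exists (M A b : nat) (s : R),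
      [/\ 0 < s /\ (0 < M)%N, exact_repair_code n k d M A b,
          ln (A%:R) <= s * alpha,
          ln (b%:R) <= s * (gamma / d%:R) &
          x = ln (M%:R) / s]].

Definition C_exact {R : realType} (n k d : nat) (alpha gamma : R) : \bar R :=
  ereal_sup [set x%:E | x in achievable_sizes n k d alpha gamma].

(* Main.v *)
Require Import Defs.
From HB Require Import structures.
From mathcomp Require Import all_boot all_order all_algebra all_fingroup zify ring.
Set Implicit Arguments. Unset Strict Implicit. Unset Printing Implicit Defensive.
Import Order.TTheory GRing.Theory Num.Theory.
Local Open Scope ring_scope.

(** Put [m = n - k + i] and [s = d - k + 1].  For every [m]-subset [S] of the
    nodes, an independent part of the file is stored on [S] with a Ye-Barg
    minimum-storage code of parameters [(m, i, d - k + i)]: the symbol of node [j]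
    in layer [a : 'I_s ^ n] is [c_(a,j)], and every layer satisfies
    [\sum_(j in S) c_(a,j) lam(j, a_j) ^+ t = 0] for [t < n - k], the [lam(j, u)]
    being pairwise distinct field elements.  Any [k] nodes meet [S] in at least [i]
    nodes, and any [d] helpers meet an [S] containing the lost node [f] in at least
    [d - k + i] nodes.  Helper [j] sends the sums of [c_(a,j)] over the layers [a]
    that differ only in [a_f]; the summed parity checks form a Vandermonde system
    with no more unknowns than equations, so they yield all [c_(a,f)].
    Using [d] copies of this code, the helper sets can be rotated so that all [d]
    helpers send the same amount. *)

(** * Vandermonde systems and codes with prescribed parity checks *)

(** A polynomial with at most [r] coefficients that vanishes at every [x p'] except [x p] combines
    the [r] equations into one whose only term is a nonzero multiple of [c p]. *)
Lemma power_sums_eq0 (F : fieldType) (I : finType) (P : {set I}) (x c : I -> F)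
    (r : nat) :
  (#|P| <= r)%N -> {in P &, injective x} ->
  (forall t, (t < r)%N -> \sum_(p in P) c p * x p ^+ t = 0) ->
  {in P, forall p, c p = 0}.
Proof.
move=> leP xI sum0 p Pp.
pose f := \prod_(p' in P :\ p) ('X - (x p')%:P).
have fsize : (size f <= r)%N.
  rewrite /f -big_enum size_prod_XsubC -cardE; apply: leq_trans leP.
  by rewrite (cardsD1 p P) Pp.
have : \sum_(p' in P) c p' * f.[x p'] = 0.
  under eq_bigr => p' _.
    rewrite (horner_coef_wide _ fsize) mulr_sumr.
    under eq_bigr => t _ do rewrite mulrCA.
    over.
  rewrite exchange_big big1 //= => t _.
  by rewrite -mulr_sumr sum0 ?mulr0.
rewrite (bigD1 p) //= big1 ?addr0 => [|p' /andP[Pp' p'p]].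
  move/eqP; rewrite mulf_eq0 => /orP[/eqP //|].
  rewrite horner_prod => /eqP fp0.
  have : \prod_(p' in P :\ p) (x p - x p') == 0.
    by rewrite -[X in _ == X]fp0; apply/eqP/eq_bigr => p' _; rewrite hornerXsubC.
  rewrite prodf_seq_eq0 => /hasP[p' _ /andP[]].
  rewrite !inE subr_eq0 => /andP[p'p Pp'] /eqP /xI eq_pp'.
  by move: p'p; rewrite eq_pp' ?eqxx.
rewrite horner_prod (bigD1 p') /=; last by rewrite !inE p'p.
by rewrite hornerXsubC subrr mul0r mulr0.
Qed.

(** The [r] checks ([H1]) and the vanishing outside [S] ([H2]) are at most [n - i] linear
    conditions, so their solution space has dimension at least [i]; [G] consists of [i] independent
    solutions. *)
Lemma exists_parity_generator (F : fieldType) (n i r : nat) (S : {set 'I_n})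
    (x : 'I_n -> F) :
  (i + r <= #|S|)%N ->
  exists G : 'M[F]_(i, n),
    [/\ row_free G,
        forall (u : 'rV_i) j, j \notin S -> (u *m G) 0 j = 0 &
        forall (u : 'rV_i) t, (t < r)%N ->
          \sum_(j in S) (u *m G) 0 j * x j ^+ t = 0].
Proof.
move=> ler.
pose H1 : 'M[F]_(n, r) := \matrix_(j, t) (x j ^+ t).
pose H2 : 'M[F]_(n, #|~: S|) := \matrix_(j, c) (j == enum_val c)%:R.
pose K := kermx (row_mx H1 H2).
have rkK : (i <= \rank K)%N.
  rewrite mxrank_ker; have := rank_leq_col (row_mx H1 H2).
  by have := cardsC S; rewrite card_ord; lia.
pose G : 'M_(i, n) := pid_mx i *m row_base K.
have GH : G *m row_mx H1 H2 = 0.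
  rewrite -mulmxA (_ : row_base K *m _ = 0) ?mulmx0 //.
  by apply/sub_kermxP; rewrite eq_row_base.
move: GH; rewrite mul_mx_row -[0]row_mx0 => /eq_row_mx [GH1 GH2].
have G0 (u : 'rV_i) j : j \notin S -> (u *m G) 0 j = 0.
  move=> jS; have jC : j \in ~: S by rewrite inE.
  have := congr1 (fun M => (u *m M) 0 (enum_rank_in jC j)) GH2.
  rewrite mulmx0 mulmxA !mxE (bigD1 j) //= big1 ?addr0.
    by rewrite !mxE enum_rankK_in // eqxx mulr1.
  by move=> j' /negPf j'j; rewrite !mxE enum_rankK_in // j'j mulr0.
exists G; split=> //.
  by rewrite /row_free mxrankMfree ?row_base_free // rank_pid_mx.
move=> u t tr.
have := congr1 (fun M => (u *m M) 0 (Ordinal tr)) GH1.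
rewrite mulmx0 mulmxA !mxE (bigID (mem S)) /= [X in _ + X]big1 ?addr0.
  by move=> e; rewrite -[RHS]e; apply: eq_bigr => j _; rewrite !mxE.
by move=> j jS; have := G0 u j jS; rewrite !mxE => ->; rewrite mul0r.
Qed.

(** * Repair within one layered block *)

Definition ffun_upd (I : finType) (T : Type) (a : {ffun I -> T}) (f : I) (u : T) :
    {ffun I -> T} :=
  [ffun j => if j == f then u else a j].

Lemma ffun_updE (I : finType) (T : Type) (a : {ffun I -> T}) (f j : I) (u : T) :
  ffun_upd a f u j = if j == f then u else a j.
Proof. by rewrite ffunE. Qed.

Lemma ffun_upd_upd (I : finType) (T : Type) (a : {ffun I -> T}) (f : I) (u v : T) :
  ffun_upd (ffun_upd a f u) f v = ffun_upd a f v.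
Proof. by apply/ffunP => j; rewrite !ffunE; case: eqP. Qed.

Lemma ffun_upd_id (I : finType) (T : Type) (a : {ffun I -> T}) (f : I) :
  ffun_upd a f (a f) = a.
Proof. by apply/ffunP => j; rewrite !ffunE; case: eqP => // ->. Qed.

(* Adding up the parity checks of the layers that differ from [a] only in
   coordinate [f] gives the parity checks of one longer code, with one unknown
   for each [c _ f] and one for each node of [S] outside [E] and [f]. *)
Lemma layered_repair (F : fieldType) (n s r : nat) (lam : 'I_n * 'I_s -> F)
    (S E : {set 'I_n}) (f : 'I_n) (u0 : 'I_s)
    (c : {ffun 'I_n -> 'I_s} -> 'I_n -> F) :
  injective lam -> f \in S -> E \subset S :\ f -> (#|S| + s <= r + #|E|.+1)%N ->
  (forall a t, (t < r)%N -> \sum_(j in S) c a j * lam (j, a j) ^+ t = 0) ->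
  (forall j (b : {ffun 'I_n -> 'I_s}), j \in E -> b f = u0 ->
     \sum_u c (ffun_upd b f u) j = 0) ->
  forall a, c a f = 0.
Proof.
move=> lamI fS ES ler parity known a.
pose mu j := \sum_u c (ffun_upd a f u) j.
(* [known] speaks only of layers whose coordinate [f] is [u0], but [mu] sums over the whole class of
   [a], which contains such a layer. *)
have mu0 j : j \in E -> mu j = 0.
  move=> jE; have := known j (ffun_upd a f u0) jE.
  rewrite ffun_updE eqxx => /(_ erefl) <-.
  by apply: eq_bigr => u _; rewrite ffun_upd_upd.
(* A node of [R] has the same [a j] throughout the class, so it contributes one evaluation point;
   [f] contributes one point for each of its [s] values. *)
pose R := S :\ f :\: E.
pose P1 := [set (j, a j) | j in R].
pose P2 := [set (f, u) | u : 'I_s].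
pose C (p : 'I_n * 'I_s) := if p.1 == f then c (ffun_upd a f p.2) f else mu p.1.
have disjP : [disjoint P1 & P2].
  rewrite -setI_eq0; apply/eqP/setP => p; rewrite !inE; apply/negP.
  move=> /andP[/imsetP[j jR ->] /imsetP[u _ [jf _]]].
  by move: jR; rewrite !inE jf eqxx andbF.
have inj1 : injective (fun j => (j, a j)) by move=> j j' [].
have inj2 : injective (fun u : 'I_s => (f, u)) by move=> u u' [].
have cardP : (#|P1 :|: P2| <= r)%N.
  rewrite cardsU disjoint_setI0 // cards0 subn0 !card_imset // card_ord.
  rewrite cardsD (setIidPr ES) cardsDS ?sub1set // cards1.
  have := subset_leq_card ES; rewrite cardsDS ?sub1set // cards1.
  have : (0 < #|S|)%N by apply/card_gt0P; exists f.
  by move: ler; move: #|S| #|E| => x y; lia.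
have key t : (t < r)%N -> \sum_(p in P1 :|: P2) C p * lam p ^+ t = 0.
  move=> tr; under eq_bigl do rewrite in_setU.
  rewrite bigU //= /P1 /P2 !big_imset /=;
    try by [move=> ? ? _ _ /inj1 | move=> ? ? _ _ /inj2].
  have : \sum_u \sum_(j in S) c (ffun_upd a f u) j * lam (j, ffun_upd a f u j) ^+ t = 0.
    by rewrite big1 // => u _; rewrite parity.
  rewrite exchange_big /= (big_setD1 f) //= addrC => e.
  rewrite -[RHS]e; congr (_ + _); last first.
    apply: eq_big => [u|u _]; first by rewrite !inE.
    by rewrite /C /= eqxx ffun_updE eqxx.
  rewrite [RHS](bigID (mem E)) /= [X in _ = X + _]big1 ?add0r => [|j /andP[jS jE]].
    apply: eq_big => [j|j]; first by rewrite !inE andbC.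
    rewrite !inE => /and3P[jE jf jS]; rewrite /C /= (negPf jf) mulr_suml.
    by apply: eq_bigr => u _; rewrite ffun_updE (negPf jf).
  transitivity (mu j * lam (j, a j) ^+ t); last by rewrite mu0 ?mul0r.
  rewrite mulr_suml; apply: eq_bigr => u _.
  by move: jS; rewrite !inE ffun_updE => /andP[/negPf -> _].
have := power_sums_eq0 cardP (in2W lamI) key (_ : (f, a f) \in P1 :|: P2).
rewrite /C /= eqxx ffun_upd_id; apply.
by rewrite inE; apply/orP; right; apply: imset_f.
Qed.

(** * Sharing the repair load equally among helpers *)

(** Take the powers of the cyclic shift of an enumeration of [D]: every orbit in [D] has length [d],
    so the first [d] powers send a point to distinct places. *)
Lemma cyclic_transversal (T : finType) (D : {set T}) (d : nat) :
  #|D| = d ->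
  exists g : 'I_d -> {perm T},
    (forall t, perm_on D (g t)) /\
    {in D, forall j, injective (fun t => g t j)}.
Proof.
move=> <-; have Du := enum_uniq D.
have nextI : injective (next (enum D)) := can_inj (prev_next Du).
have iterE t j : (perm nextI ^+ t)%g j = iter t (next (enum D)) j.
  by rewrite permX; apply: eq_iter => x; rewrite permE.
exists (fun t => (perm nextI ^+ t)%g); split=> [t|j jD t t'] /=.
  apply/subsetP => j; rewrite inE; apply: contraR => jD.
  rewrite iterE; elim: (t : nat) => //= m /eqP ->.
  by rewrite next_nth mem_enum (negPf jD).
have order_j : fingraph.order (next (enum D)) j = #|D|.
  by rewrite (order_cycle (cycle_next Du) Du) ?mem_enum // -cardE.
rewrite !iterE -!(@nth_traject _ (next (enum D)) _ #|D|) // => /eqP.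
rewrite nth_uniq ?size_traject ?ltn_ord //; first by move/eqP/val_inj.
by rewrite -order_j orbit_uniq.
Qed.

(* A fixed choice [E0] of [e] helpers for each block is transported along the
   cyclic shifts of [D]; over the [d] shifts every helper is used equally. *)
Lemma balanced_choice (T : finType) (D : {set T}) (A : {set {set T}}) (d e : nat) :
  #|D| = d ->
  (forall (g : {perm T}) (S : {set T}), perm_on D g -> (g @: S \in A) = (S \in A)) ->
  {in A, forall S, (e <= #|S :&: D|)%N} ->
  exists E : {set T} -> 'I_d -> {set T},
    (forall S t, S \in A -> E S t \subset S :&: D /\ #|E S t| = e) /\
    {in D, forall j, #|[set p : {set T} * 'I_d | (p.1 \in A) && (j \in E p.1 p.2)]|
                     = (#|A| * e)%N}.
Proof.
move=> cardD stabA leA; have [g [gD gI]] := cyclic_transversal cardD.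
have [E0 E0P] : exists E0 : {set T} -> {set T},
    forall S, S \in A -> E0 S \subset S :&: D /\ #|E0 S| = e.
  apply: (@fin_all_exists _ (fun _ => {set T}) (fun S B =>
    S \in A -> B \subset S :&: D /\ #|B| = e)) => S.
  case: (boolP (S \in A)) => [SA|_]; last by exists set0.
  have : (0 < #|[set B : {set T} | B \subset S :&: D & #|B| == e]|)%N.
    by rewrite cards_draws bin_gt0 leA.
  by case/card_gt0P => B; rewrite inE => /andP[? /eqP ?]; exists B.
have gstab t j : (g t j \in D) = (j \in D) by rewrite perm_closed.
exists (fun (S : {set T}) t => g t @^-1: E0 (g t @: S)); split=> [S t SA|j jD].
  have [sub card_e] := E0P (g t @: S) (etrans (stabA _ _ (gD t)) SA); split.
    apply/subsetP => j; rewrite inE => /(subsetP sub).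
    by rewrite !inE gstab mem_imset //; apply: perm_inj.
  by rewrite on_card_preimset ?card_e //; apply: onW_bij; exists (g t)^-1%g;
     [apply: permK | apply: permKV].
(* For fixed [t], replacing [g t @: S] by [S] turns the condition into [g t j \in E0 S]. As [t]
   varies, [g t j] runs once through [D], so each [S] in [A] is counted [#|E0 S| = e] times. *)
rewrite -sum1_card.
rewrite (eq_bigl (fun p : {set T} * 'I_d =>
  (p.1 \in A) && (g p.2 j \in E0 (g p.2 @: p.1)))); last first.
  by move=> p; rewrite !inE.
rewrite -(pair_big_dep (mem A)
  (fun (S : {set T}) t => g t j \in E0 (g t @: S)) (fun _ _ => 1%N)) /=.
rewrite (exchange_big_dep predT) //=.
under eq_bigr => t _.
  rewrite (eq_bigl (fun S : {set T} =>
    (g t @: S \in A) && (g t j \in E0 (g t @: S)))); last first.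
    by move=> S; rewrite stabA.
  rewrite -(reindex_inj (imset_inj (@perm_inj _ (g t)))
    (P := fun S : {set T} => (S \in A) && (g t j \in E0 S)) (F := fun _ => 1%N)).
  over.
rewrite -(exchange_big_dep predT) //= -sum_nat_const; apply: eq_bigr => S SA.
have [sub <-] := E0P S SA.
have -> : (\sum_(t | g t j \in E0 S) 1)%N = #|[set t | g t j \in E0 S]|.
  by rewrite -sum1_card; apply: eq_bigl => t; rewrite inE.
rewrite -(card_imset _ (gI j jD)).
apply: eq_card => y; apply/idP/idP => [/imsetP[t + ->]|yE]; first by rewrite inE.
have yD : y \in D by move/(subsetP sub): yE; rewrite inE => /andP[].
have : y \in [set g t j | t : 'I_d].
  suff -> : [set g t j | t : 'I_d] = D by [].
  apply/eqP; rewrite eqEcard card_imset ?card_ord ?cardD ?leqnn ?andbT; last exact: gI.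
  by apply/subsetP => _ /imsetP[t _ ->]; rewrite gstab.
by case/imsetP => t _ ye; apply/imsetP; exists t; rewrite // inE -ye.
Qed.

(** * Counting lemmas and passage to ordinal alphabets *)

Lemma card_draws_mem (T : finType) (m : nat) (f : T) :
  (0 < m)%N -> #|[set S : {set T} | (#|S| == m) && (f \in S)]| = 'C(#|T|.-1, m.-1).
Proof.
case: m => // m _ /=.
have <- : #|[set~ f]| = #|T|.-1 by rewrite cardsC1.
rewrite -(cards_draws [set~ f] m) -[LHS](@card_in_imset _ _ (fun S : {set T} => S :\ f)).
  apply: eq_card => S; rewrite !inE; apply/imsetP/andP.
    move=> [B]; rewrite inE => /andP[/eqP cB fB ->]; split.
      by apply/subsetP => y; rewrite !inE => /andP[].
    by rewrite -eqSS -cB (cardsD1 f B) fB.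
  move=> [Sf /eqP cS]; have fS : f \notin S.
    by apply/negP => /(subsetP Sf); rewrite !inE eqxx.
  by exists (f |: S); rewrite ?setU1K // inE cardsU1 fS cS eqxx setU11.
move=> B C; rewrite !inE => /andP[_ fB] /andP[_ fC] BC.
by rewrite -(setD1K fB) BC setD1K.
Qed.

Lemma card_ffun_fixed (I : finType) (s : nat) (f : I) :
  #|[set a : {ffun I -> 'I_s.+1} | a f == ord0]| = (s.+1 ^ #|I|.-1)%N.
Proof.
have <- : #|[set~ f]| = #|I|.-1 by rewrite cardsC1.
rewrite -[in RHS](card_ord s.+1) -(card_pffun_on (@ord0 s)).
apply: eq_card => a; rewrite inE; apply/eqP/pffun_onP => [af|[/subsetP sup _]].
  split=> //; apply/subsetP => j; rewrite !inE.
  by apply: contraNneq => ->; rewrite af.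
apply/eqP; apply: contraT => /sup.
by rewrite !inE eqxx.
Qed.

Lemma encode_in_ord (V : finType) (v0 : V) (X : {pred V}) (A : nat) :
  (0 < A)%N -> (#|X| <= A)%N ->
  exists e : (V -> 'I_A) * ('I_A -> V), {in X, cancel e.1 e.2}.
Proof.
case: A => // A _ leXA.
exists (fun v => inord (index v (enum X)), fun y : 'I_A.+1 => nth v0 (enum X) y).
move=> v vX /=; rewrite inordK ?nth_index ?mem_enum //.
by apply: leq_trans leXA; rewrite cardE index_mem mem_enum.
Qed.

(** Allows files, contents and messages to live in convenient finite types: only the sizes of the
    sets [C], [X j] and [Y j] of admissible values matter, since these values can be renumbered. *)
Lemma exact_repair_code_finType (n k d A b : nat) (W V U : finType) (v0 : V) (u0 : U)
    (C : {pred W}) (store : 'I_n -> W -> V) (X : 'I_n -> {pred V}) :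
  (0 < A)%N -> (0 < b)%N ->
  (forall j, #|X j| <= A)%N -> (forall j w, store j w \in X j) ->
  (forall K : {set 'I_n}, #|K| = k -> {in C &, forall w1 w2,
     (forall j, j \in K -> store j w1 = store j w2) -> w1 = w2}) ->
  (forall (f : 'I_n) (D : {set 'I_n}), #|D| = d -> f \notin D ->
     exists (msg : 'I_n -> V -> U) (Y : 'I_n -> {pred U}),
       [/\ forall j, j \in D -> (#|Y j| <= b)%N,
           forall j v, msg j v \in Y j &
           forall w1 w2,
             (forall j, j \in D -> msg j (store j w1) = msg j (store j w2)) ->
             store f w1 = store f w2]) ->
  exact_repair_code n k d #|C| A b.
Proof.
move=> A0 b0 leX storeX rec rep.
have [e eK] := fin_all_exists (fun j => encode_in_ord v0 A0 (leX j)).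
exists (fun j w => (e j).1 (store j (enum_val w))); split.
  move=> K cK w1 w2 eqK; apply: enum_val_inj.
  apply: (rec K cK); rewrite ?enum_valP // => j jK.
  by rewrite -(eK j _ (storeX j _)) eqK // eK.
move=> f D cD fD; have [msg [Y [leY msgY repf]]] := rep f D cD fD.
have [e' e'K] : exists e' : forall j : 'I_n, (U -> 'I_b) * ('I_b -> U),
    forall j, j \in D -> {in Y j, cancel (e' j).1 (e' j).2}.
  apply: (@fin_all_exists _ _ (fun j (e' : (U -> 'I_b) * ('I_b -> U)) =>
    j \in D -> {in Y j, cancel e'.1 e'.2})) => j.
  case: (boolP (j \in D)) => [jD|_].
    by have [e' e'K] := encode_in_ord u0 b0 (leY j jD); exists e'.
  by exists (fun=> Ordinal b0, fun=> u0).
exists (fun j y => (e' j).1 (msg j ((e j).2 y))) => w1 w2 eqD.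
congr ((e f).1 _); apply: repf => j jD.
have := eqD j jD; rewrite !eK ?storeX // => /(congr1 (e' j).2).
by rewrite !e'K ?msgY.
Qed.

Lemma pffun_on_if (F : nmodType) (I : finType) (P : {pred I}) (g : I -> F) :
  [ffun x => if x \in P then g x else 0] \in pffun_on 0 P predT.
Proof.
apply/pffun_onP; split=> //; apply/subsetP => x.
by rewrite inE ffunE; case: ifP => //; rewrite eqxx.
Qed.

Lemma exists_injective_finField (T : finType) :
  exists (F : finFieldType) (x : T -> F), injective x.
Proof.
have [p ltp pr_p] := prime_above #|T|.
exists 'F_p, (fun t => (enum_rank t)%:R) => t t' /(congr1 val).
rewrite /= !val_Fp_nat // !modn_small; try exact: ltn_trans ltp.
by move/val_inj/enum_rank_inj.
Qed.

(** * The code over all blocks *)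

(** The exponents count field elements. Each block, copy and layer carries [i] of them; a node lies
    in ['C(n.-1, (n - k + i).-1)] blocks; balancing makes a helper serve [d - k + i] times per block
    containing the lost node, each time with one sum per class of layers. *)
Lemma layered_exact_repair_code (n k d i : nat) :
  (0 < k)%N -> (k <= d)%N -> (d < n)%N -> (0 < i)%N -> (i <= k)%N ->
  exists2 q, (1 < q)%N &
    exact_repair_code n k d
      (q ^ (i * ('C(n, n - k + i) * d * (d - k + 1) ^ n)))
      (q ^ ('C(n.-1, (n - k + i).-1) * d * (d - k + 1) ^ n))
      (q ^ ('C(n.-1, (n - k + i).-1) * (d - k + i) * (d - k + 1) ^ n.-1)).
Proof.
move=> k0 lekd ltdn i0 leik; rewrite addn1.
set m := (n - k + i)%N; set s := (d - k).+1; set N1 := 'C(n.-1, m.-1).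
have m0 : (0 < m)%N by rewrite /m; lia.
have [F [lam lamI]] := exists_injective_finField ('I_n * 'I_s)%type.
have q0 : (0 < #|F|)%N by apply/card_gt0P; exists 0.
exists #|F|; first exact: card_finNzRing_gt1.
pose L := {ffun 'I_n -> 'I_s}.
pose I := ({set 'I_n} * 'I_d * L)%type.
have [G GP] : exists G : {set 'I_n} * L -> 'M[F]_(i, n),
  forall x : {set 'I_n} * L, #|x.1| = m ->
    [/\ row_free (G x),
        forall (u : 'rV_i) j, j \notin x.1 -> (u *m G x) 0 j = 0 &
        forall (u : 'rV_i) t, (t < n - k)%N ->
          \sum_(j in x.1) (u *m G x) 0 j * lam (j, x.2 j) ^+ t = 0].
  apply: (@fin_all_exists _ (fun _ => 'M[F]_(i, n)) 
    (fun (x : {set 'I_n} * L) Gx => #|x.1| = m ->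
    [/\ row_free Gx,
        forall (u : 'rV_i) j, j \notin x.1 -> (u *m Gx) 0 j = 0 &
        forall (u : 'rV_i) t, (t < n - k)%N ->
          \sum_(j in x.1) (u *m Gx) 0 j * lam (j, x.2 j) ^+ t = 0])) => x.
  have [cx|ncx] := eqVneq #|x.1| m; last by exists 0 => cx; rewrite cx eqxx in ncx.
  have [|Gx GxP] := @exists_parity_generator F n i (n - k) x.1
    (fun j => lam (j, x.2 j)); first by rewrite cx /m addnC.
  by exists Gx.
(* A file is a message vector per block, copy and layer. [C] puts zero on the sets of size other
   than [m], which are not blocks. *)
pose W := {ffun I -> 'rV[F]_i}.
pose C : {pred W} := pffun_on 0 [set x : I | #|x.1.1| == m] predT.
pose cw (w : W) (x : I) j := (w x *m G (x.1.1, x.2)) 0 j.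
pose blocks (j : 'I_n) := [set S : {set 'I_n} | (#|S| == m) && (j \in S)].
have card_blocks j : #|blocks j| = N1 by rewrite card_draws_mem // card_ord.
pose supX (j : 'I_n) := [set x : I | x.1.1 \in blocks j].
pose store j (w : W) : {ffun I -> F} :=
  [ffun x => if x \in supX j then cw w x j else 0].
have cwB w1 w2 x j : cw (w1 - w2) x j = cw w1 x j - cw w2 x j.
  by rewrite /cw !ffunE mulmxBl !mxE.
have cardI (P : {set {set 'I_n}}) : #|[set x : I | x.1.1 \in P]| = (#|P| * d * s ^ n)%N.
  have -> : [set x : I | x.1.1 \in P] = setX (setX P setT) setT.
    by apply/setP => x; rewrite !inE !andbT.
  by rewrite !cardsX !cardsT card_ffun !card_ord.
have cardC : #|C| = (#|F| ^ (i * ('C(n, m) * d * s ^ n)))%N.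
  rewrite card_pffun_on (_ : [set x : I | _] =
    [set x : I | x.1.1 \in [set S : {set 'I_n} | #|S| == m]]).
    by rewrite cardI card_draws card_ord card_mx mul1n -expnM.
  by apply/setP => x; rewrite !inE.
rewrite -cardC.
apply: (@exact_repair_code_finType n k d _ _ W {ffun I -> F} {ffun I -> F} 0 0
  C store (fun j => pffun_on 0 (supX j) predT)); rewrite ?expn_gt0 ?q0 //.
- by move=> j; rewrite card_pffun_on cardI card_blocks.
- by move=> j w; apply: pffun_on_if.
- move=> K cK w1 w2 /pffun_onP[/subsetP sup1 _] /pffun_onP[/subsetP sup2 _] eqK.
  apply/ffunP => x; have [cx|ncx] := eqVneq #|x.1.1| m; last first.
    have w0 (w : W) : {subset 0.-support w <= [set x : I | #|x.1.1| == m]} -> w x = 0.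
      by move=> sup; apply/eqP; apply: contraT => /sup; rewrite inE (negPf ncx).
    by rewrite !w0.
  have [freeG G0 parity] := GP (x.1.1, x.2) cx; rewrite /= in G0 parity.
  (* The difference of the two codewords vanishes on [K], which leaves at most [n - k] unknowns for
     the [n - k] checks. *)
  have diff0 : {in x.1.1 :\: K, forall j, cw (w1 - w2) x j = 0}.
    apply: (@power_sums_eq0 _ _ _ (fun j => lam (j, x.2 j)) _ (n - k)).
    - have := cardsUI x.1.1 K; have := max_card (mem (x.1.1 :|: K)).
      rewrite cardsD card_ord cx cK.
      have := subset_leq_card (subsetIl x.1.1 K); rewrite cx /m.
      by move: #|_ :|: _| #|_ :&: _| => y z; lia.
    - by move=> j j' _ _ /lamI[].
    - move=> t tr; rewrite -[RHS](parity ((w1 - w2) x) t tr) [RHS](bigID (mem K)) /=.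
      rewrite [X in _ = X + _]big1 ?add0r => [|j /andP[jS jK]].
        by apply: eq_bigl => j; rewrite inE andbC.
      rewrite -/(cw (w1 - w2) x j) cwB.
      have := congr1 (fun v : {ffun I -> F} => v x) (eqK j jK).
      by rewrite !ffunE !inE cx eqxx jS /= => ->; rewrite subrr mul0r.
  apply/eqP; rewrite -subr_eq0; apply/eqP.
  apply: (row_free_inj freeG); rewrite mul0mx; apply/rowP => j; rewrite [RHS]mxE.
  have -> : w1 x - w2 x = (w1 - w2) x by rewrite !ffunE.
  have [jS|] := boolP (j \in x.1.1); last exact: G0.
  have [jK|jK] := boolP (j \in K); last by apply: diff0; rewrite inE jK.
  rewrite -/(cw (w1 - w2) x j) cwB.
  have := congr1 (fun v : {ffun I -> F} => v x) (eqK j jK).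
  by rewrite !ffunE !inE cx eqxx jS /= => ->; rewrite subrr.
move=> f D cD fD.
have [|S|E [EP Ebal]] := @balanced_choice _ D (blocks f) d (d - k + i) cD.
(* A permutation moving only points of [D] fixes [f], hence permutes the blocks through [f]. *)
- move=> g S gD; rewrite !inE card_imset; last exact: perm_inj.
  by rewrite -{1}(out_perm gD fD) mem_imset //; apply: perm_inj.
- rewrite inE => /andP[/eqP cS _].
  have := cardsUI S D; rewrite cS cD /m.
  have := max_card (mem (S :|: D)); rewrite card_ord.
  by move: #|_ :|: _| #|_ :&: _| => y z; lia.
(* The layers with [a f = ord0] represent the classes of layers differing only at [f], so each sum
   is sent once. *)
pose supY (j : 'I_n) :=
  setX [set x : {set 'I_n} * 'I_d | (x.1 \in blocks f) && (j \in E x.1 x.2)]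
       [set a : L | a f == ord0].
pose msg j (v : {ffun I -> F}) : {ffun I -> F} :=
  [ffun x => if x \in supY j then \sum_u v (x.1, ffun_upd x.2 f u) else 0].
exists msg, (fun j => pffun_on (0 : F) (supY j) predT : {pred {ffun I -> F}}); split.
- move=> j jD; rewrite card_pffun_on cardsX Ebal // card_blocks card_ffun_fixed.
  by rewrite card_ord.
- by move=> j v; apply: pffun_on_if.
move=> w1 w2 eqD; apply/ffunP => -[[S t] a]; rewrite !ffunE.
case: ifPn => //; rewrite inE /= => Sf.
have [sub card_E] := EP S t Sf.
have [cS fS] : #|S| = m /\ f \in S by move: Sf; rewrite inE => /andP[/eqP].
(* By linearity it suffices to repair [w1 - w2], for which all the helper sums are zero. *)
apply/eqP; rewrite -subr_eq0 -cwB; apply/eqP.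
apply: (@layered_repair F n s (n - k) lam S (E S t) f ord0
  (fun a => cw (w1 - w2) (S, t, a))) => //.
- apply/subsetP => j /(subsetP sub); rewrite !inE => /andP[-> jD].
  by rewrite andbT; apply: contraNneq fD => <-.
(* Equality holds here: there are as many unknowns as checks. *)
- by rewrite card_E cS /m /s; lia.
- by move=> a' t' lt'; have [_ _] := GP (S, a') cS; apply.
move=> j b jE bf.
have /andP[jS jD] : (j \in S) && (j \in D) by move/(subsetP sub): jE; rewrite inE.
have := congr1 (fun v : {ffun I -> F} => v (S, t, b)) (eqD j jD).
rewrite !ffunE !inE /= cS eqxx fS jE bf eqxx /= => eqm.
under eq_bigr do rewrite cwB.
rewrite big_split /= sumrN; apply/eqP; rewrite subr_eq0; apply/eqP.
have storeE w : \sum_u cw w (S, t, ffun_upd b f u) j =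
    \sum_u store j w (S, t, ffun_upd b f u).
  by apply: eq_bigr => u _; rewrite ffunE !inE /= cS eqxx jS.
by rewrite !storeE.
Qed.

(* From alphabet sizes to the capacity bound *)
From mathcomp Require Import all_classical all_reals all_analysis.

Lemma ln_natX (R : realType) (q e : nat) :
  (0 < q)%N -> ln (q ^ e)%:R = e%:R * ln q%:R :> R.
Proof. by move=> q0; rewrite natrX lnXn ?ltr0n // mulr_natl. Qed.

Theorem theorem3p2 (R : realType) (n k d : nat) (alpha : R)
  (hk : (0 < k)%N) (hkd : (k <= d)%N) (hdn : (d < n)%N) (halpha : 0 < alpha)
  (i : nat) (hi1 : (1 <= i)%N) (hik : (i <= k)%N) :
  ((n%:R * i%:R * alpha / (n - k + i)%:R)%:E
    <= C_exact n k d alpha ((d - k + i)%:R * alpha / (d - k + 1)%:R))%E.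
Proof.
have [q q1 code] := layered_exact_repair_code hk hkd hdn hi1 hik.
have q0 : (0 < q)%N by apply: ltnW.
set m := (n - k + i)%N in code *; set s := (d - k + 1)%N in code *.
set N1 := 'C(n.-1, m.-1) in code.
have m0 : (0 < m)%N by rewrite /m; lia.
have s0 : (0 < s)%N by rewrite /s; lia.
have d0 : (0 < d)%N by lia.
have n0 : (0 < n)%N by lia.
have N10 : (0 < N1)%N by rewrite bin_gt0 /m; lia.
(* Incidences of nodes and blocks, counted in two ways; this turns the ratio ['C(n, m) / N1] into
   [n / m]. *)
have binE : n%:R * N1%:R = m%:R * 'C(n, m)%:R :> R.
  by rewrite -!natrM mul_bin_diag prednK.
have lnq : 0 < ln (q%:R : R) by rewrite ln_gt0 // ltr1n.
have sn0 : (0 < s ^ n)%N by rewrite expn_gt0 s0.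
have snE : (s ^ n)%:R = s%:R * (s ^ n.-1)%:R :> R.
  by rewrite -natrM -expnS prednK.
have [mR sR dR NR anz] : [/\ m%:R != 0 :> R, s%:R != 0 :> R, d%:R != 0 :> R,
    N1%:R != 0 :> R & alpha != 0].
  by split; rewrite ?gt_eqF ?ltr0n.
have snR : (s ^ n.-1)%:R != 0 :> R by rewrite gt_eqF // ltr0n expn_gt0 s0.
apply: ereal_sup_ubound; exists (n%:R * i%:R * alpha / m%:R) => //.
(* The scaling makes the node size exactly [alpha]; the bandwidth constraint is then an equality as
   well. *)
eexists _, _, _, (ln q%:R * (N1 * d * s ^ n)%:R / alpha); split; first split.
- by rewrite divr_gt0 // mulr_gt0 // ltr0n !muln_gt0 N10 d0.
- 2: exact: code.
- by rewrite expn_gt0 q0.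
- by rewrite ln_natX // divfK // mulrC.
- rewrite ln_natX // le_eqVlt; apply/orP; left; apply/eqP.
  by rewrite !natrM snE; field; rewrite anz sR dR.
rewrite ln_natX // !natrM snE.
have -> : 'C(n, m)%:R = n%:R * N1%:R / m%:R :> R by rewrite binE mulrC mulKf.
by field; rewrite mR anz snR sR dR NR gt_eqF.
Qed.
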